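(* Let $V=S(\mathbb{H})\subset\mathbb{C}$ be the image on $\mathbb{H}=\{w\in\mathbb{C}:\operatorname{Im} w>0\}$ of the function $S(w)=F(w)+G(w)$, where $F(w)=\sum_{n=0}^{\infty}e(2^n w)$ and $G(w)=\sum_{l=1}^{\infty}e\left(-\frac{1}{2^l}\right)\left(e\left(\frac{w}{2^l}\right)-1\right)$. For $m\in\mathbb{Z}$ put $c_m=\sum_{l=1}^{\infty}\left(e\left(\frac{m}{2^l}\right)-1\right)$. Then $V+\mathbb{Z}=V$, and moreover $V+c_m\subset V$ for each $m\in\mathbb{Z}$.
   Context: Notation: $e(w)=\exp(2\pi i w)$ for $w\in\mathbb{C}$. The series $F$ converges on $\mathbb{H}$ and defines a holomorphic function there. The series $G$ converges uniformly on compact subsets of $\mathbb{C}$ and defines an entire function. Hence $S$ is holomorphic on $\mathbb{H}$. The series defining $c_m$ converges absolutely. Here $V+\mathbb{Z}=\{v+n: v\in V,\ n\in\mathbb{Z}\}$ and $V+c_m=\{v+c_m: v\in V\}$. *)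

(* Defs.v *)
From Stdlib Require Import Reals ZArith.
From Coquelicot Require Import Coquelicot.
Open Scope C_scope.

Definition Cexp (z : C) : C := RtoC (exp (Re z)) * (cos (Im z), sin (Im z)).

Definition e (w : C) : C := Cexp (2 * PI * Ci * w).

(** Total sum operator on complex sequences, in the style of [RInt]: its value
    is meaningful when the series converges in [C] (see [CSeries_unique]). *)
Definition CSeries (a : nat -> C) : C :=
  iota (fun s : C_CompleteNormedModule => @is_series C_AbsRing C_NormedModule a s).

Lemma CSeries_unique (a : nat -> C) (s : C) :
  @is_series C_AbsRing C_NormedModule a s -> CSeries a = s.
Proof.
intros Ha.
exact (@iota_filterlim_locally C_AbsRing C_CompleteNormedModule nat eventually
         _ (sum_n a) s Ha).
Qed.

(** Sum over l = 1, 2, 3, ... *)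
Definition CSeries1 (a : nat -> C) : C := CSeries (fun k : nat => a (k + 1)%nat).

Definition F (w : C) : C := CSeries (fun n : nat => e (2 ^ n * w)).

Definition G (w : C) : C :=
  CSeries1 (fun l : nat => e (- (1 / 2 ^ l)) * (e (w / 2 ^ l) - 1)).

(** Only meant for [w] in the upper half-plane, where [F] converges. *)
Definition Sfun (w : C) : C := F w + G w.

Definition upper_half_plane (w : C) : Prop := (0 < Im w)%R.

Definition image (f : C -> C) (A : C -> Prop) (z : C) : Prop :=
  exists w : C, A w /\ z = f w.

Definition V : C -> Prop := image Sfun upper_half_plane.

Definition c (m : Z) : C :=
  CSeries1 (fun l : nat => e (IZR m / 2 ^ l) - 1).

Definition plus_Z (A : C -> Prop) (z : C) : Prop :=
  exists (v : C) (n : Z), A v /\ z = v + IZR n.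

Definition translate (A : C -> Prop) (t : C) (z : C) : Prop :=
  exists v : C, A v /\ z = v + t.

(* Main.v *)
(** Shifting [w] by 1 turns [Sfun] into [S0 - const], where
    [S0 w = F w + sum_{l >= 1} (e (w / 2^l) - 1)] is a two-sided lacunary series
    with [S0 (2 w) = S0 w - 1].  Hence [V] is invariant under integer translations.
    For [m] an integer, [S0 (w / 2^k + m) - k] tends to [S0 w + c m] uniformly on
    bounded subsets of the half-plane as [k] tends to infinity, so Hurwitz's theorem
    shows that the values of [S0 + c m] are values of [S0] up to integers.  Hurwitz's
    theorem is obtained from the minimum modulus principle: where [S0] misses a value,
    its distance to that value can be decreased locally, because some derivative of
    [S0] is nonzero at every point. *)

Require Import Defs.
From Stdlib Require Import Reals ZArith.
From Coquelicot Require Import Coquelicot.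
From Stdlib Require Import Lra Lia Classical_Prop.
Local Open Scope C_scope.

(** For [u = w / 2^k] close to 0, passing from [u] to [u + m] leaves [F] unchanged and changes [G0]
    by [c m + O(|u|)], while [S0 u = S0 w + k]; this is where the limit [S0 w + c m] comes from. A
    limit of values need not be a value, hence the appeal to Hurwitz. The points [w / 2^k + m]
    approach the real axis, so non-constancy is needed at every height, not only high up, where a
    single exponential can be made to dominate. Since [S0 (2^k * w)] and [S0 w] differ by a
    constant, an expansion at a high point transfers to all lower ones. Holomorphy enters only
    through Taylor expansions with explicit remainders, obtained termwise from the exponential: the
    lowest nonvanishing order gives both the lower bound around a point and the direction of
    descent. *)

Local Notation sums a s := (@is_series C_AbsRing C_NormedModule a s).

(** * Convergence and domination of complex series *)

Lemma sums_ext (a b : nat -> C) (s : C) :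
  (forall n, a n = b n) -> sums a s -> sums b s.
Proof. intros H Ha; exact (is_series_ext a b s H Ha). Qed.

Lemma sums_plus (a b : nat -> C) (s t : C) :
  sums a s -> sums b t -> sums (fun n => a n + b n) (s + t).
Proof. exact (is_series_plus a b s t). Qed.

Lemma sums_scal (k : C) (a : nat -> C) (s : C) :
  sums a s -> sums (fun n => k * a n) (k * s).
Proof. exact (@is_series_scal C_AbsRing C_NormedModule k a s). Qed.

Lemma sums_minus (a b : nat -> C) (s t : C) :
  sums a s -> sums b t -> sums (fun n => a n - b n) (s - t).
Proof. exact (is_series_minus a b s t). Qed.

Lemma sums_tail (a : nat -> C) (s : C) :
  sums a s -> sums (fun n => a (S n)) (s - a 0%nat).
Proof.
intros Ha; apply (@is_series_incr_1 C_AbsRing C_NormedModule).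
replace (plus _ _) with s; [exact Ha|].
change (s = s - a 0%nat + a 0%nat); ring.
Qed.

Lemma sums_cons (a : nat -> C) (s : C) :
  sums (fun n => a (S n)) s -> sums a (a 0%nat + s).
Proof.
intros Ha; apply (@is_series_decr_1 C_AbsRing C_NormedModule).
replace (plus _ _) with s; [exact Ha|].
change (s = a 0%nat + s - a 0%nat); ring.
Qed.

Lemma sums_unique (a : nat -> C) (s t : C) : sums a s -> sums a t -> s = t.
Proof.
intros Hs Ht; rewrite <- (CSeries_unique a s Hs); exact (CSeries_unique a t Ht).
Qed.

Lemma Cmod_sum_n_le (a : nat -> C) (b : nat -> R) (n : nat) :
  (forall k, (Cmod (a k) <= b k)%R) -> (Cmod (sum_n a n) <= sum_n b n)%R.
Proof.
intros Hab; induction n as [|n IH].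
- rewrite !sum_O; apply Hab.
- rewrite !sum_Sn; eapply Rle_trans; [apply Cmod_triangle|].
  apply Rplus_le_compat; [exact IH|apply Hab].
Qed.

Lemma sums_dominated (a : nat -> C) (b : nat -> R) (B : R) :
  (forall n, (Cmod (a n) <= b n)%R) -> is_series b B ->
  exists s : C, sums a s /\ (Cmod s <= B)%R.
Proof.
intros Hab Hb.
destruct (@ex_series_le C_AbsRing C_CompleteNormedModule a b) as [s Hs].
- exact Hab.
- exists B; exact Hb.
- exists s; split; [exact Hs|].
  assert (Hl : is_lim_seq (fun n => Cmod (sum_n a n)) (Cmod s)).
  { apply (filterlim_comp _ _ _ _ (@norm C_AbsRing C_NormedModule) _ _ _ Hs).
    exact (@filterlim_norm C_AbsRing C_NormedModule s). }
  exact (is_lim_seq_le _ _ (Cmod s) B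
           (fun n => Cmod_sum_n_le a b n Hab) Hl Hb).
Qed.

Lemma Cmod_sums_le (a : nat -> C) (b : nat -> R) (s : C) (B : R) :
  sums a s -> (forall n, (Cmod (a n) <= b n)%R) -> is_series b B ->
  (Cmod s <= B)%R.
Proof.
intros Ha Hab Hb; destruct (sums_dominated a b B Hab Hb) as [t [Ht HB]].
rewrite (sums_unique a s t Ha Ht); exact HB.
Qed.

(** * The complex exponential and its Taylor remainders *)

Lemma Cexp_plus (u v : C) : Cexp (u + v) = Cexp u * Cexp v.
Proof.
destruct u as [a b], v as [x y].
unfold Cexp; simpl; rewrite exp_plus, cos_plus, sin_plus.
unfold Cmult, RtoC; simpl; apply injective_projections; simpl; ring.
Qed.

Lemma Cexp_0 : Cexp 0 = 1.
Proof.
unfold Cexp; simpl; rewrite exp_0, cos_0, sin_0.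
apply injective_projections; simpl; ring.
Qed.

Lemma Cmod_Cexp (u : C) : Cmod (Cexp u) = exp (Re u).
Proof.
unfold Cexp; rewrite Cmod_mult, Cmod_R, Rabs_pos_eq by (left; apply exp_pos).
unfold Cmod at 1; simpl.
replace (_ + _)%R with 1%R; [rewrite sqrt_1; ring|].
pose proof (sin2_cos2 (Im u)) as H; unfold Rsqr in H; lra.
Qed.

(** [N] counts the subtracted monomials [u^0, ..., u^(N-1)], so the remainder has order [u^N] at
    0. *)
Fixpoint Cexp_rem (N : nat) (u : C) : C :=
  match N with
  | O => Cexp u
  | S N => Cexp_rem N u - u ^ N / RtoC (INR (fact N))
  end.

(** Along the ray [s * u] each remainder differentiates to [u] times the previous one, and [pred]
    covers [N = 0], where the exponential reproduces itself. The multiplier [k] selects a real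
    linear functional, so that real mean value estimates apply. *)
Lemma Cexp_rem_deriv (N : nat) (k u : C) (t : R) :
  is_derive (fun s : R => Re (k * Cexp_rem N (s * u))) t
    (Re (k * (u * Cexp_rem (pred N) (t * u)))).
Proof.
induction N as [|N IH].
- destruct k as [x y], u as [a b]; unfold Cexp_rem, Cexp; simpl.
  auto_derive; [trivial|].
  replace (t * a + - (0 * b))%R with (t * a - 0 * b)%R by ring.
  unfold Rminus; ring.
- apply (is_derive_ext (fun s : R => minus (Re (k * Cexp_rem N (s * u)))
           (s ^ N / INR (fact N) * Re (k * u ^ N))%R)).
  { intro s; simpl Cexp_rem; change minus with Rminus.
    unfold Rminus; rewrite <- Ropp_mult_distr_l_reverse, <- re_scal_l, <- re_plus.
    f_equal; rewrite Cpow_mult_l, RtoC_opp, RtoC_div, RtoC_pow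
      by apply INR_fact_neq_0.
    field; intro H; apply (INR_fact_neq_0 N), RtoC_inj, H. }
  assert (Hp : is_derive (fun s : R => (s ^ N / INR (fact N) * Re (k * u ^ N))%R) t
    (INR N * t ^ pred N / INR (fact N) * Re (k * u ^ N))%R).
  { generalize (Re (k * u ^ N)) (INR (fact N)); intros a b; auto_derive; [trivial|].
    unfold Rdiv; ring. }
  replace (Re (k * (u * Cexp_rem (pred (S N)) (t * u)))) with
    (minus (Re (k * (u * Cexp_rem (pred N) (t * u))))
       (INR N * t ^ pred N / INR (fact N) * Re (k * u ^ N))%R);
    [exact (is_derive_minus _ _ _ _ _ IH Hp)|].
  change minus with Rminus; destruct N as [|N].
  { simpl; unfold Rdiv; ring. }
  simpl pred.
  replace (INR (S N) * t ^ N / INR (fact (S N)))%R with (t ^ N / INR (fact N))%R.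
  2:{ rewrite fact_simpl, mult_INR; field; split;
      [apply INR_fact_neq_0|apply not_0_INR; discriminate]. }
  unfold Rminus; rewrite <- Ropp_mult_distr_l_reverse, <- re_scal_l, <- re_plus.
  f_equal; simpl Cexp_rem; rewrite Cpow_S, Cpow_mult_l, RtoC_opp, RtoC_div, RtoC_pow
      by apply INR_fact_neq_0.
  field; intro H; apply (INR_fact_neq_0 N), RtoC_inj, H.
Qed.

Lemma Cexp_rem_0 (N : nat) : Cexp_rem (S N) 0 = 0.
Proof.
induction N as [|N IH].
- simpl; rewrite Cexp_0; field.
- change (Cexp_rem (S N) 0 - 0 ^ S N / RtoC (INR (fact (S N))) = 0).
  rewrite IH, Cpow_S; field.
  intro H; apply (INR_fact_neq_0 (S N)), RtoC_inj, H.
Qed.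

(** The factor [t] is there for the induction: the mean value estimate needs the previous bound
    along the whole segment. Dropping the factor [1/N!] costs nothing, since only the order in [u]
    matters. *)
Lemma Cmod_Cexp_rem_segment (N : nat) (u : C) (t : R) :
  (Rabs t <= 1)%R -> (Cmod (Cexp_rem N (t * u)) <= Cmod u ^ N * exp (Cmod u))%R.
Proof.
revert t; induction N as [|N IH]; intros t Ht.
- simpl Cexp_rem; rewrite Cmod_Cexp, pow_O, Rmult_1_l, re_scal_l.
  assert (Hle : (t * Re u <= Cmod u)%R).
  { eapply Rle_trans; [apply Rle_abs|]; rewrite Rabs_mult.
    pose proof (re_le_Cmod u); pose proof (Rabs_pos (Re u)).
    pose proof (Rabs_pos t); nra. }
  destruct Hle as [Hlt| ->]; [left; apply exp_increasing, Hlt|right; reflexivity].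
- set (z := Cexp_rem (S N) (t * u)).
  destruct (Req_dec (Cmod z) 0) as [H0|H0].
  { rewrite H0; apply Rmult_le_pos; [apply pow_le, Cmod_ge_0|left; apply exp_pos]. }
  (* The mean value inequality applied to the real function [Re (conj z * _)],
     whose value at [t] is [|z|^2]. *)
  assert (Hbv : (Rabs (Re (Cconj z * z) - Re (Cconj z * Cexp_rem (S N) (0%R * u)))
    <= Cmod z * (Cmod u * (Cmod u ^ N * exp (Cmod u))) * Rabs (t - 0))%R).
  { apply (bounded_variation
      (fun s : R => Re (Cconj z * Cexp_rem (S N) (s * u)))
      (fun s : R => Re (Cconj z * (u * Cexp_rem N (s * u))))).
    intros s Hs; split; [apply (Cexp_rem_deriv (S N))|].
    eapply Rle_trans; [apply re_le_Cmod|]; rewrite !Cmod_mult, Cmod_conj.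
    apply Rmult_le_compat_l; [apply Cmod_ge_0|].
    apply Rmult_le_compat_l; [apply Cmod_ge_0|].
    apply IH; rewrite !Rminus_0_r in Hs; lra. }
  replace (0%R * u) with (RtoC 0) in Hbv by ring.
  rewrite Cexp_rem_0 in Hbv.
  replace (Re (Cconj z * z)) with (Cmod z ^ 2)%R in Hbv
    by (rewrite Cmod2_alt; destruct z as [x y]; simpl; ring).
  replace (Re (Cconj z * 0)) with 0%R in Hbv by (destruct z; simpl; ring).
  rewrite !Rminus_0_r in Hbv.
  pose proof (Cmod_ge_0 z) as Hz.
  rewrite Rabs_pos_eq in Hbv by (apply pow2_ge_0).
  apply Rmult_le_reg_l with (Cmod z); [lra|].
  rewrite <- tech_pow_Rmult.
  set (B := (Cmod u ^ N * exp (Cmod u))%R) in *.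
  assert (0 <= Cmod u * B)%R.
  { apply Rmult_le_pos; [apply Cmod_ge_0|].
    apply Rmult_le_pos; [apply pow_le, Cmod_ge_0|left; apply exp_pos]. }
  assert (Cmod z * (Cmod u * B) * Rabs t <= Cmod z * (Cmod u * B) * 1)%R.
  { apply Rmult_le_compat_l; [apply Rmult_le_pos|]; assumption. }
  replace (Cmod u * Cmod u ^ N * exp (Cmod u))%R with (Cmod u * B)%R
    by (unfold B; ring).
  lra.
Qed.

Lemma Cmod_Cexp_rem (N : nat) (u : C) :
  (Cmod (Cexp_rem N u) <= Cmod u ^ N * exp (Cmod u))%R.
Proof.
rewrite <- (Cmult_1_l u) at 1; apply Cmod_Cexp_rem_segment.
rewrite Rabs_R1; apply Rle_refl.
Qed.

Lemma e_plus (u v : C) : e (u + v) = e u * e v.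
Proof. unfold e; rewrite <- Cexp_plus; f_equal; ring. Qed.

Lemma Cmod_e (w : C) : Cmod (e w) = exp (- (2 * PI * Im w)).
Proof.
unfold e; rewrite Cmod_Cexp; f_equal; destruct w; simpl; ring.
Qed.

Lemma e_0 : e 0 = 1.
Proof. unfold e; rewrite Cmult_0_r; apply Cexp_0. Qed.

Lemma e_nat (n : nat) : e (INR n) = 1.
Proof.
unfold e, Cexp; simpl.
replace (_ + (_ + _) * INR n)%R with (0 + 2 * INR n * PI)%R by ring.
rewrite cos_period, sin_period, cos_0, sin_0.
replace (_ - _)%R with 0%R by ring; rewrite exp_0.
apply injective_projections; simpl; ring.
Qed.

Lemma e_IZR (m : Z) : e (IZR m) = 1.
Proof.
destruct (Z_le_gt_dec 0 m) as [Hm|Hm].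
- rewrite <- (Z2Nat.id m Hm), <- INR_IZR_INZ; apply e_nat.
- assert (H : e (IZR m) * e (IZR (- m)) = 1).
  { rewrite <- e_plus, <- RtoC_plus, <- plus_IZR, Z.add_opp_diag_r; apply e_0. }
  rewrite <- (Z2Nat.id (- m)), <- INR_IZR_INZ, e_nat in H by lia.
  rewrite <- H; ring.
Qed.

Lemma e_plus_IZR (w : C) (m : Z) : e (w + IZR m) = e w.
Proof. rewrite e_plus, e_IZR; ring. Qed.

(** * Exponential series with real frequencies and their Taylor expansions *)

Definition tau : C := 2 * PI * Ci.

Lemma Cmod_tau : Cmod tau = (2 * PI)%R.
Proof.
unfold tau; rewrite !Cmod_mult, Cmod_Ci, !Cmod_R, !Rabs_pos_eq; try lra.
left; apply PI_RGT_0.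
Qed.

(** The power starts at [S j] because for the frequencies [1 / 2^l] the series of order 0 diverges,
    its terms tending to 1; only the derivatives converge without subtracting a constant from each
    term. *)
Definition rapid (lam : nat -> R) : Prop :=
  (forall n, (0 <= lam n)%R) /\
  forall (j : nat) (y : R), (0 < y)%R ->
    ex_series (fun n => lam n ^ S j * exp (- (y * lam n)))%R.

(** The constant term is left out: it would be the value [f z] itself, which is not a termwise sum
    at order 0 when a constant has been subtracted from the terms. *)
Fixpoint taylor_poly (D : nat -> C) (N : nat) (h : C) : C :=
  match N with
  | O => 0
  | S N => taylor_poly D N h + D (S N) * (h ^ S N / RtoC (INR (fact (S N))))
  end.

(** This takes the place of holomorphy. [K] is uniform on a whole half-plane, so order 0 already
    yields a Lipschitz constant, while the higher orders detect the first nonvanishing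
    derivative. *)
Definition has_taylor (f : C -> C) (D : nat -> C -> C) : Prop :=
  forall (N : nat) (eta : R), (0 < eta)%R ->
  exists K : R, (0 <= K)%R /\ forall z h : C, (eta <= Im z)%R ->
    (Cmod h <= eta / 2)%R ->
    (Cmod (f (z + h) - f z - taylor_poly (fun j => D j z) N h)%C
      <= K * Cmod h ^ S N)%R.

Definition deriv_term (lam : nat -> R) (j : nat) (z : C) (n : nat) : C :=
  (tau * lam n) ^ j * e (lam n * z).

Lemma Cmod_deriv_term (lam : nat -> R) (j : nat) (z : C) (n : nat) :
  (0 <= lam n)%R ->
  Cmod (deriv_term lam j z n)
    = ((2 * PI) ^ j * (lam n ^ j * exp (- (2 * PI * Im z * lam n))))%R.
Proof.
intros Hl; unfold deriv_term.
rewrite Cmod_mult, Cmod_pow, Cmod_e, Cmod_mult, Cmod_tau, Cmod_R, Rabs_pos_eq by apply Hl.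
rewrite Rpow_mult_distr, Rmult_assoc; do 3 f_equal.
rewrite im_scal_l; ring.
Qed.

Lemma deriv_sums (lam : nat -> R) (j : nat) (z : C) :
  rapid lam -> (0 < Im z)%R ->
  sums (deriv_term lam (S j) z) (CSeries (deriv_term lam (S j) z)).
Proof.
intros [Hl Hr] Hz; pose proof PI_RGT_0 as Hpi.
destruct (Hr j (2 * PI * Im z)%R) as [B HB]; [nra|].
destruct (sums_dominated (deriv_term lam (S j) z)
  (fun n => (2 * PI) ^ S j * (lam n ^ S j * exp (- (2 * PI * Im z * lam n))))%R
  ((2 * PI) ^ S j * B)) as [s [Hs _]].
- intro n; right; apply Cmod_deriv_term, Hl.
- exact (is_series_scal _ _ _ HB).
- rewrite (CSeries_unique _ _ Hs); exact Hs.
Qed.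

(** The constant [k] cancels in [f (z + h) - f z], and the remainder of [f] is the sum of the
    remainders of the exponentials. Their growth [exp (2 pi lam |h|)] uses up at most half of the
    decay [exp (- 2 pi lam eta)], because [|h| <= eta / 2]; the rate [PI * eta] is what is left. *)
Lemma series_taylor (lam : nat -> R) (k : C) (f : C -> C) :
  rapid lam ->
  (forall z, (0 < Im z)%R -> sums (fun n => e (lam n * z) - k) (f z)) ->
  has_taylor f (fun j z => CSeries (deriv_term lam j z)).
Proof.
intros Hrap Hf N eta Heta; pose proof PI_RGT_0 as Hpi.
destruct Hrap as [Hl Hr]; destruct (Hr N (PI * eta)%R) as [B HB]; [nra|].
assert (HB0 : (0 <= B)%R).
{ apply (is_series_ext _ (fun n => Rabs (lam n ^ S N * exp (- (PI * eta * lam n)))%R))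
    in HB.
  - rewrite <- (is_series_unique _ _ HB).
    rewrite <- (Rmult_0_l (Series (fun _ => 0%R))).
    rewrite <- Series_scal_l; apply Series_le; [|eexists; exact HB].
    intro n; rewrite Rmult_0_l; split; [apply Rle_refl|apply Rabs_pos].
  - intro n; rewrite Rabs_pos_eq; [reflexivity|].
    apply Rmult_le_pos; [apply pow_le, Hl|left; apply exp_pos]. }
exists ((2 * PI) ^ S N * B)%R; split.
{ apply Rmult_le_pos; [apply pow_le; lra|exact HB0]. }
intros z h Hz Hh.
assert (Hzh : (0 < Im (z + h))%R).
{ rewrite im_plus; pose proof (Rle_trans _ _ _ (Rmax_r _ _) (Rmax_Cmod h)) as Hm.
  change (snd h) with (Im h) in Hm; apply Rabs_le_between in Hm; lra. }
assert (Hsum : sums (fun n => e (lam n * z) * Cexp_rem (S N) (tau * lam n * h))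
  (f (z + h) - f z - taylor_poly (fun j => CSeries (deriv_term lam j z)) N h)).
{ clear - Hf Hzh Hz Heta Hl Hr; induction N as [|N IH].
  - apply (sums_ext (fun n => (e (lam n * (z + h)) - k) - (e (lam n * z) - k))).
    + intro n; rewrite Cmult_plus_distr_l, e_plus; unfold e at 2.
      simpl; fold tau; rewrite Cmult_assoc; field.
    + replace (_ - _ - _) with (f (z + h) - f z) by (simpl; ring).
      apply sums_minus; apply Hf; lra.
  - apply (sums_ext (fun n => e (lam n * z) * Cexp_rem (S N) (tau * lam n * h)
      - h ^ S N / RtoC (INR (fact (S N))) * deriv_term lam (S N) z n)).
    + intro n; change (Cexp_rem (S (S N)) (tau * lam n * h))
        with (Cexp_rem (S N) (tau * lam n * h)
          - (tau * lam n * h) ^ S N / RtoC (INR (fact (S N)))).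
      unfold deriv_term; rewrite !(Cpow_mult_l _ h).
      unfold Cdiv; ring.
    + change (taylor_poly (fun j => CSeries (deriv_term lam j z)) (S N) h)
        with (taylor_poly (fun j => CSeries (deriv_term lam j z)) N h
          + CSeries (deriv_term lam (S N) z) * (h ^ S N / RtoC (INR (fact (S N))))).
      replace (_ - _ - _) with (f (z + h) - f z -
        taylor_poly (fun j => CSeries (deriv_term lam j z)) N h
        - h ^ S N / RtoC (INR (fact (S N))) * CSeries (deriv_term lam (S N) z))
        by ring.
      apply sums_minus; [exact IH|].
      apply sums_scal, deriv_sums; [split; assumption|lra]. }
apply (Cmod_sums_le _ (fun n => (2 * PI * Cmod h) ^ S N
  * (lam n ^ S N * exp (- (PI * eta * lam n))))%R _ _ Hsum).
- intro n; rewrite Cmod_mult, Cmod_e.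
  eapply Rle_trans.
  { apply Rmult_le_compat_l; [left; apply exp_pos|apply Cmod_Cexp_rem]. }
  rewrite !Cmod_mult, Cmod_tau, Cmod_R, Rabs_pos_eq by apply Hl.
  replace (2 * PI * lam n * Cmod h)%R with (2 * PI * Cmod h * lam n)%R by ring.
  rewrite Rpow_mult_distr.
  rewrite (Rmult_comm (exp _)), !Rmult_assoc, <- exp_plus, <- !Rmult_assoc.
  apply Rmult_le_compat_l.
  { pose proof (Cmod_ge_0 h); specialize (Hl n).
    apply Rmult_le_pos; apply pow_le; [nra|exact Hl]. }
  assert (Hle : (2 * PI * Cmod h * lam n + - (2 * PI * Im (lam n * z))
     <= - (PI * eta * lam n))%R).
  { rewrite im_scal_l; specialize (Hl n).
    assert (PI * lam n * (2 * Cmod h - 2 * Im z) <= PI * lam n * (- eta))%R; [|lra].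
    apply Rmult_le_compat_l; [nra|lra]. }
  destruct Hle as [Hlt| ->]; [left; apply exp_increasing, Hlt|right; reflexivity].
- replace ((2 * PI) ^ S N * B * Cmod h ^ S N)%R with ((2 * PI * Cmod h) ^ S N * B)%R
    by (rewrite Rpow_mult_distr; ring).
  exact (is_series_scal _ _ _ HB).
Qed.

Lemma taylor_poly_plus (D D' : nat -> C) (N : nat) (h : C) :
  taylor_poly (fun j => D j + D' j) N h = taylor_poly D N h + taylor_poly D' N h.
Proof.
induction N as [|N IH]; simpl taylor_poly; [|rewrite IH]; ring.
Qed.

Lemma has_taylor_plus (f f' : C -> C) (D D' : nat -> C -> C) :
  has_taylor f D -> has_taylor f' D' ->
  has_taylor (fun z => f z + f' z) (fun j z => D j z + D' j z).
Proof.
intros H H' N eta Heta.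
destruct (H N eta Heta) as [K [HK Hf]], (H' N eta Heta) as [K' [HK' Hf']].
exists (K + K')%R; split; [lra|intros z h Hz Hh].
rewrite (taylor_poly_plus (fun j => D j z)).
replace (_ - _) with
  ((f (z + h) - f z - taylor_poly (fun j => D j z) N h) +
   (f' (z + h) - f' z - taylor_poly (fun j => D' j z) N h)) by ring.
eapply Rle_trans; [apply Cmod_triangle|].
rewrite Rmult_plus_distr_r; apply Rplus_le_compat; auto.
Qed.

Lemma taylor_lipschitz (f : C -> C) (D : nat -> C -> C) (eta : R) :
  has_taylor f D -> (0 < eta)%R -> exists L : R, (0 <= L)%R /\
  forall z h : C, (eta <= Im z)%R -> (Cmod h <= eta / 2)%R ->
    (Cmod (f (z + h) - f z)%C <= L * Cmod h)%R.
Proof.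
intros Hf Heta; destruct (Hf O eta Heta) as [L [HL H]].
exists L; split; [exact HL|intros z h Hz Hh].
replace (f (z + h) - f z) with (f (z + h) - f z - taylor_poly (fun j => D j z) 0 h)
  by (simpl; ring).
rewrite <- (pow_1 (Cmod h)); auto.
Qed.

(** * Leading terms: isolation of values and descent *)

(** Quantitative non-constancy near [z]: a nonzero monomial of degree at least 1 and an error one
    order smaller. *)
Definition leading_term (f : C -> C) (z : C) : Prop :=
  exists (N : nat) (a : C) (K eta : R), a <> 0 /\ (0 <= K)%R /\ (0 < eta)%R /\
  forall h : C, (Cmod h <= eta)%R ->
    (Cmod (f (z + h) - f z - a * h ^ S N)%C <= K * Cmod h ^ S (S N))%R.

(** Strong induction reaches the least order with a nonzero derivative; all lower terms of the
    Taylor polynomial then vanish. *)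
Lemma taylor_leading_term (f : C -> C) (D : nat -> C -> C) (z : C) (j : nat) :
  has_taylor f D -> (0 < Im z)%R -> D (S j) z <> 0 -> leading_term f z.
Proof.
intros Hf Hz; induction j as [j IH] using lt_wf_ind; intros Hj.
destruct (classic (exists i, (i < j)%nat /\ D (S i) z <> 0))
  as [[i [Hi Hne]]|Hno]; [exact (IH i Hi Hne)|].
assert (Hvan : forall N h, (N <= j)%nat -> taylor_poly (fun i => D i z) N h = 0).
{ induction N as [|N IHN]; intros h HN; simpl taylor_poly; [reflexivity|].
  rewrite IHN by lia.
  destruct (classic (D (S N) z = 0)) as [->|Hne]; [ring|].
  exfalso; apply Hno; exists N; split; [lia|exact Hne]. }
destruct (Hf (S j) (Im z) Hz) as [K [HK HT]].
assert (Hfact : RtoC (INR (fact (S j))) <> 0).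
{ intro H; apply (INR_fact_neq_0 (S j)), RtoC_inj, H. }
exists j, (D (S j) z / RtoC (INR (fact (S j)))), K, (Im z / 2)%R.
split; [|split; [exact HK|split; [lra|]]].
- intro H; apply Hj.
  replace (D (S j) z) with (D (S j) z / RtoC (INR (fact (S j))) * RtoC (INR (fact (S j))))
    by (field; exact Hfact).
  rewrite H; ring.
- intros h Hh.
  replace (_ - _) with (f (z + h) - f z - taylor_poly (fun i => D i z) (S j) h).
  + apply HT; [apply Rle_refl|exact Hh].
  + change (taylor_poly (fun i => D i z) (S j) h) with (taylor_poly (fun i => D i z) j h
      + D (S j) z * (h ^ S j / RtoC (INR (fact (S j))))).
    rewrite Hvan by lia; field; exact Hfact.
Qed.

(** The third bound on [r] makes the error at most half of the leading term when [|h| <= 2 * r]. An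
    annulus is used instead of a circle because it contains the boundary of the square of half-side
    [r]. *)
Lemma leading_term_lower_bound (f : C -> C) (z : C) (rho : R) :
  leading_term f z -> (0 < rho)%R ->
  exists r delta : R, (0 < r)%R /\ (2 * r <= rho)%R /\ (0 < delta)%R /\
  forall h : C, (r <= Cmod h <= 2 * r)%R -> (delta <= Cmod (f (z + h) - f z)%C)%R.
Proof.
intros (N & a & K & eta & Ha & HK & Heta & H) Hrho.
apply Cmod_gt_0 in Ha.
set (r := Rmin (Rmin (rho / 2) (eta / 2)) (Cmod a / (4 * (K + 1)))).
assert (Hr : (0 < r)%R).
{ repeat apply Rmin_pos; try lra; apply Rdiv_lt_0_compat; lra. }
assert (Hr1 : (r <= rho / 2)%R) by (eapply Rle_trans; [apply Rmin_l|apply Rmin_l]).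
assert (Hr2 : (r <= eta / 2)%R) by (eapply Rle_trans; [apply Rmin_l|apply Rmin_r]).
assert (Hr3 : (4 * (K + 1) * r <= Cmod a)%R).
{ apply Rle_trans with (4 * (K + 1) * (Cmod a / (4 * (K + 1))))%R.
  - apply Rmult_le_compat_l; [lra|apply Rmin_r].
  - right; field; lra. }
exists r, (r ^ S N * (Cmod a / 2))%R; split; [exact Hr|].
split; [lra|split].
{ apply Rmult_lt_0_compat; [apply pow_lt, Hr|lra]. }
intros h [Hh1 Hh2].
specialize (H h ltac:(lra)).
assert (Htri : (Cmod (a * h ^ S N)
   <= Cmod (f (z + h) - f z)%C + Cmod (f (z + h) - f z - a * h ^ S N)%C)%R).
{ rewrite <- (Cmod_opp (f (z + h) - f z - a * h ^ S N)).
  eapply Rle_trans; [|apply Cmod_triangle]; right; f_equal; ring. }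
rewrite Cmod_mult, Cmod_pow in Htri.
assert (Hpow : (r ^ S N <= Cmod h ^ S N)%R) by (apply pow_incr; lra).
assert (Hrp : (0 < r ^ S N)%R) by (apply pow_lt, Hr).
rewrite <- (tech_pow_Rmult (Cmod h) (S N)) in H.
set (p := (Cmod h ^ S N)%R) in *.
assert (r ^ S N * (Cmod a / 2) <= p * (Cmod a - K * Cmod h))%R; [|lra].
apply Rmult_le_compat; nra.
Qed.

Lemma Cexp_pow (u : C) (n : nat) : Cexp u ^ n = Cexp (INR n * u).
Proof.
induction n as [|n IH].
- simpl; rewrite Cmult_0_l, Cexp_0; reflexivity.
- rewrite Cpow_S, IH, <- Cexp_plus, S_INR, RtoC_plus; f_equal; ring.
Qed.

Lemma Cexp_imaginary (t : R) : Cexp (0, t)%R = (cos t, sin t).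
Proof.
unfold Cexp; simpl; rewrite exp_0; apply injective_projections; simpl; ring.
Qed.

(** Every unit complex number is an [S N]-th power of a unit, so [w ^ S N] can be given any
    argument; one of [0], [PI], [PI / 2], [- PI / 2] makes the real part negative. *)
Lemma exists_direction (b : C) (N : nat) :
  b <> 0 -> exists w : C, Cmod w = 1%R /\ (Re (b * w ^ S N) < 0)%R.
Proof.
intros Hb.
assert (Hroot : forall t : R, exists w : C, Cmod w = 1%R /\ w ^ S N = (cos t, sin t)).
{ intro t; exists (Cexp (0, t / INR (S N))%R); split.
  - rewrite Cmod_Cexp; apply exp_0.
  - rewrite Cexp_pow, <- Cexp_imaginary; f_equal.
    assert (INR (S N) <> 0%R) by (apply not_0_INR; discriminate).
    apply injective_projections; simpl fst; simpl snd.
    + ring.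
    + change (INR (S N) * (t / INR (S N)) + 0 * 0 = t)%R; field; assumption. }
assert (Ht : exists t : R, (Re b * cos t - Im b * sin t < 0)%R).
{ destruct (Rtotal_order (Re b) 0) as [H|[H|H]].
  - exists 0%R; rewrite cos_0, sin_0; lra.
  - destruct (Rtotal_order (Im b) 0) as [H'|[H'|H']].
    + exists (- (PI / 2))%R; rewrite cos_neg, sin_neg, cos_PI2, sin_PI2; lra.
    + exfalso; apply Hb; destruct b; simpl in *; subst; reflexivity.
    + exists (PI / 2)%R; rewrite cos_PI2, sin_PI2; lra.
  - exists PI; rewrite cos_PI, sin_PI; lra. }
destruct Ht as [t Ht], (Hroot t) as [w [Hw Hpow]].
exists w; split; [exact Hw|].
rewrite Hpow, re_mult; exact Ht.
Qed.

(** Expand [|1 + x|^2] and use [m <= (1 + m^2) / 2], that is [(m - 1)^2 >= 0]. *)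
Lemma Cmod_1_plus_le (x : C) : (Cmod (1 + x) <= 1 + Re x + Cmod x ^ 2 / 2)%R.
Proof.
pose proof (Cmod_ge_0 (1 + x)); pose proof (Cmod2_alt (1 + x)) as H1.
pose proof (Cmod2_alt x) as H2; destruct x as [a b]; simpl Re in *; simpl Im in *.
rewrite H2; set (m := Cmod _) in *; pose proof (pow2_ge_0 (m - 1)); simpl in *; lra.
Qed.

(** With [h = t * w] and [s = t ^ S N], the new difference is [g * (1 + s * c)] plus an error of
    size [K * s * t]. As [Re c < 0], the gain is of order [s], and the losses are of orders [s^2]
    and [s * t]. *)
Lemma leading_term_descent (f : C -> C) (z v : C) (rho : R) :
  leading_term f z -> f z <> v -> (0 < rho)%R ->
  exists h : C, (Cmod h < rho)%R /\ (Cmod (f (z + h) - v)%C < Cmod (f z - v)%C)%R.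
Proof.
intros (N & a & K & eta & Ha & HK & Heta & H) Hv Hrho.
set (g := f z - v).
assert (Hg : g <> 0).
{ intro Hg; apply Hv; replace (f z) with (g + v) by (unfold g; ring).
  rewrite Hg; ring. }
assert (Hb : a / g <> 0).
{ intro Hb; apply Ha; replace a with (a / g * g) by (field; exact Hg).
  rewrite Hb; ring. }
destruct (exists_direction (a / g) N Hb) as [w [Hw Hre]].
set (c := a / g * w ^ S N) in *.
pose proof Hg as Hg'; apply Cmod_gt_0 in Hg'.
(* Since [s <= t], all losses together are at most [s * t * Q]; the summand 1 keeps [Q] positive for
   the division below. *)
set (Q := (Cmod g * (Cmod c ^ 2 / 2) + K + 1)%R).
assert (HQ : (0 < Q)%R) by (unfold Q; pose proof (pow2_ge_0 (Cmod c)); nra).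
set (t := Rmin (Rmin (rho / 2) eta) (Rmin 1 (Cmod g * (- Re c) / (2 * Q)))).
assert (Hpos : (0 < Cmod g * - Re c)%R) by nra.
assert (Ht : (0 < t)%R).
{ repeat apply Rmin_pos; try lra; apply Rdiv_lt_0_compat; lra. }
assert (Ht1 : (t <= rho / 2)%R) by (eapply Rle_trans; [apply Rmin_l|apply Rmin_l]).
assert (Ht2 : (t <= eta)%R) by (eapply Rle_trans; [apply Rmin_l|apply Rmin_r]).
assert (Ht3 : (t <= 1)%R) by (eapply Rle_trans; [apply Rmin_r|apply Rmin_l]).
assert (Ht4 : (t * Q < Cmod g * (- Re c))%R).
{ apply Rle_lt_trans with (Cmod g * (- Re c) / (2 * Q) * Q)%R.
  - apply Rmult_le_compat_r; [lra|eapply Rle_trans; [apply Rmin_r|apply Rmin_r]].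
  - replace (Cmod g * - Re c / (2 * Q) * Q)%R with (Cmod g * - Re c / 2)%R
      by (field; lra).
    lra. }
assert (Hmod : Cmod (t * w) = t) by (rewrite Cmod_mult, Hw, Cmod_R, Rabs_pos_eq; lra).
exists (t * w); rewrite Hmod; split; [lra|].
specialize (H (t * w) ltac:(lra)); rewrite Hmod in H.
set (s := (t ^ S N)%R).
assert (Hs0 : (0 < s)%R) by (apply pow_lt, Ht).
assert (Hst : (s <= t)%R).
{ unfold s; rewrite <- tech_pow_Rmult.
  pose proof (pow_incr t 1 N ltac:(lra)) as Hp; rewrite pow1 in Hp.
  pose proof (pow_lt t N Ht); nra. }
rewrite <- (tech_pow_Rmult t (S N)) in H; fold s in H.
replace (f (z + t * w) - v) with
  ((f (z + t * w) - f z - a * (t * w) ^ S N) + g * (1 + s * c)).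
2:{ unfold s, c; rewrite Cpow_mult_l, RtoC_pow.
    replace (f z) with (g + v) by (unfold g; ring); field; exact Hg. }
eapply Rle_lt_trans; [apply Cmod_triangle|].
rewrite Cmod_mult.
pose proof (Cmod_1_plus_le (s * c)) as H1.
rewrite re_scal_l, Cmod_mult, Cmod_R, Rabs_pos_eq in H1 by lra.
assert (H2 : (Cmod g * Cmod (1 + s * c)
   <= Cmod g * (1 + s * Re c + (s * Cmod c) ^ 2 / 2))%R)
  by (apply Rmult_le_compat_l; lra).
assert (H3 : (s * (Cmod g * (Cmod c ^ 2 / 2) * s + K * t) < s * (Cmod g * - Re c))%R).
{ apply Rmult_lt_compat_l; [exact Hs0|].
  apply Rle_lt_trans with (t * Q)%R; [|exact Ht4].
  unfold Q; pose proof (pow2_ge_0 (Cmod c)).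
  assert (Cmod g * (Cmod c ^ 2 / 2) * s <= Cmod g * (Cmod c ^ 2 / 2) * t)%R;
    [apply Rmult_le_compat_l; [nra|exact Hst]|lra]. }
lra.
Qed.

(** * Minima on a square and Hurwitz's theorem *)

(** A square instead of a disc, since the compactness argument runs over a rectangle in the two real
    coordinates. *)
Definition in_square (z0 : C) (r : R) (z : C) : Prop :=
  (Rabs (Re z - Re z0) <= r /\ Rabs (Im z - Im z0) <= r)%R.

Lemma Cmod_le_Re_Im (z : C) : (Cmod z <= Rabs (Re z) + Rabs (Im z))%R.
Proof.
pose proof (Cmod2_alt z); pose proof (Cmod_ge_0 z).
pose proof (Rabs_pos (Re z)); pose proof (Rabs_pos (Im z)).
pose proof (pow2_abs (Re z)); pose proof (pow2_abs (Im z)); nra.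
Qed.

(* If the infimum is not attained, [phi] exceeds it near each point by at least the
   radius of the neighbourhood, so by compactness it exceeds it uniformly. *)
Lemma square_min (phi : C -> R) (z0 : C) (r L : R) :
  (0 <= r)%R -> (0 <= L)%R -> (forall z, 0 <= phi z)%R ->
  (forall z w, in_square z0 r z -> in_square z0 r w ->
     phi z <= phi w + L * Cmod (z - w)%C)%R ->
  exists z, in_square z0 r z /\ forall w, in_square z0 r w -> (phi z <= phi w)%R.
Proof.
intros Hr HL Hphi Hlip.
destruct (completeness (fun x => exists z, in_square z0 r z /\ x = - phi z)%R)
  as [m [Hub Hlub]].
{ exists 0%R; intros x [z [_ ->]]; specialize (Hphi z); lra. }
{ exists (- phi z0)%R, z0; split; [|reflexivity].
  split; rewrite Rminus_diag_eq, Rabs_R0 by reflexivity; exact Hr. }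
assert (Hlow : forall z, in_square z0 r z -> (- m <= phi z)%R).
{ intros z Hz; assert (- phi z <= m)%R; [apply Hub; exists z; auto|lra]. }
apply NNPP; intro Hno.
assert (Hgap : forall z, in_square z0 r z -> (- m < phi z)%R).
{ intros z Hz; destruct (Hlow z Hz) as [|Heq]; [assumption|].
  exfalso; apply Hno; exists z; split; [exact Hz|].
  intros w Hw; rewrite <- Heq; apply Hlow, Hw. }
(* Here [- m] is the infimum. The denominator pays for a variation of at most [2 * L * d0] over the
   neighbourhood and leaves an excess of [d0]. The default radius 1 in [d] only makes it total: on
   the square [d0] is positive by [Hgap]. *)
set (d0 := fun u v : R => ((phi (u, v) + m) / (2 * L + 1))%R).
set (d := fun u v => match Rlt_dec 0 (d0 u v) with
  | left H => mkposreal _ H | right _ => mkposreal 1 Rlt_0_1 end).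
destruct (compactness_value_2d (Re z0 - r) (Re z0 + r) (Im z0 - r) (Im z0 + r) d)
  as [eps Heps].
assert (Hall : forall z, in_square z0 r z -> (- m + eps <= phi z)%R).
{ intros z [Hz1 Hz2]; apply Rnot_lt_le; intro Hlt.
  apply (Heps (Re z) (Im z)); [apply Rabs_le_between in Hz1; lra
    |apply Rabs_le_between in Hz2; lra|].
  intros (u & v & Hu & Hv & Hxu & Hyv & He).
  assert (Huv : in_square z0 r (u, v))
    by (split; simpl; apply Rabs_le_between; lra).
  pose proof (Hgap _ Huv) as Hg.
  assert (Hd : pos (d u v) = d0 u v).
  { unfold d; destruct (Rlt_dec 0 (d0 u v)) as [|Hn]; [reflexivity|].
    exfalso; apply Hn; unfold d0; apply Rdiv_lt_0_compat; lra. }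
  rewrite Hd in *.
  assert (Hval : (phi (u, v) = - m + (2 * L + 1) * d0 u v)%R)
    by (unfold d0; field; lra).
  pose proof (Hlip (u, v) z Huv (conj Hz1 Hz2)) as Hl.
  pose proof (Cmod_le_Re_Im ((u, v) - z)) as Hc; destruct z as [x y]; simpl in *.
  change (u + - x)%R with (u - x)%R in Hc; change (v + - y)%R with (v - y)%R in Hc.
  rewrite (Rabs_minus_sym u x), (Rabs_minus_sym v y) in Hc.
  assert (L * Cmod ((u, v) - (x, y))%C <= L * (2 * d0 u v))%R
    by (apply Rmult_le_compat_l; lra).
  lra. }
assert (m <= m - eps)%R; [|destruct eps as [? ?]; simpl in *; lra].
apply Hlub; intros x [z [Hz ->]]; specialize (Hall z Hz); lra.
Qed.

(** The distance from [g] to [f z0] is below [delta / 2] at the centre and above it on the boundary,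
    so its minimum is attained inside. There the descent hypothesis, applied with the distance to
    the boundary as [rho], contradicts minimality unless the value is attained. *)
Lemma hurwitz_square (f g : C -> C) (z0 : C) (r delta L : R) :
  (0 <= r)%R -> (0 <= L)%R ->
  (forall z, in_square z0 r z ->
     Rabs (Re z - Re z0) = r \/ Rabs (Im z - Im z0) = r ->
     (delta <= Cmod (f z - f z0)%C)%R) ->
  (forall z, in_square z0 r z -> (Cmod (g z - f z)%C < delta / 2)%R) ->
  (forall z w, in_square z0 r z -> in_square z0 r w ->
     (Cmod (g z - g w)%C <= L * Cmod (z - w)%C)%R) ->
  (forall z rho, in_square z0 r z -> g z <> f z0 -> (0 < rho)%R ->
     exists h : C, (Cmod h < rho)%R /\
       (Cmod (g (z + h) - f z0)%C < Cmod (g z - f z0)%C)%R) ->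
  exists z, in_square z0 r z /\ g z = f z0.
Proof.
intros Hr HL Hbd Hclose Hlip Hdesc.
destruct (square_min (fun z => Cmod (g z - f z0)) z0 r L Hr HL) as [z [Hz Hmin]].
{ intro; apply Cmod_ge_0. }
{ intros z w Hz Hw; specialize (Hlip z w Hz Hw).
  replace (g z - f z0) with ((g w - f z0) + (g z - g w)) by ring.
  eapply Rle_trans; [apply Cmod_triangle|lra]. }
exists z; split; [exact Hz|].
apply NNPP; intro Hne.
assert (Hz0 : in_square z0 r z0)
  by (split; rewrite Rminus_diag_eq, Rabs_R0 by reflexivity; exact Hr).
pose proof (Hmin z0 Hz0) as H0; pose proof (Hclose z0 Hz0) as H0'.
assert (Hno : ~ (Rabs (Re z - Re z0) = r \/ Rabs (Im z - Im z0) = r)).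
{ intro Hb; specialize (Hbd z Hz Hb); specialize (Hclose z Hz).
  pose proof (Cmod_triangle (g z - f z0) (- (g z - f z))) as Ht.
  rewrite Cmod_opp in Ht.
  replace (g z - f z0 + - (g z - f z)) with (f z - f z0) in Ht by ring; lra. }
destruct Hz as [Hz1 Hz2].
assert (Hlt1 : (Rabs (Re z - Re z0) < r)%R)
  by (destruct Hz1; [assumption|exfalso; apply Hno; auto]).
assert (Hlt2 : (Rabs (Im z - Im z0) < r)%R)
  by (destruct Hz2; [assumption|exfalso; apply Hno; auto]).
destruct (Hdesc z (Rmin (r - Rabs (Re z - Re z0)) (r - Rabs (Im z - Im z0)))
  (conj Hz1 Hz2) Hne) as [h [Hh Hlt]]; [apply Rmin_pos; lra|].
apply (Rlt_not_le _ _ Hlt), Hmin.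
pose proof (Rmin_l (r - Rabs (Re z - Re z0)) (r - Rabs (Im z - Im z0))).
pose proof (Rmin_r (r - Rabs (Re z - Re z0)) (r - Rabs (Im z - Im z0))).
pose proof (Rle_trans _ _ _ (Rmax_l _ _) (Rmax_Cmod h)) as Hh1.
pose proof (Rle_trans _ _ _ (Rmax_r _ _) (Rmax_Cmod h)) as Hh2.
change (fst h) with (Re h) in Hh1; change (snd h) with (Im h) in Hh2.
split.
- rewrite re_plus; replace (Re z + Re h - Re z0)%R with (Re z - Re z0 + Re h)%R by ring.
  eapply Rle_trans; [apply Rabs_triang|lra].
- rewrite im_plus; replace (Im z + Im h - Im z0)%R with (Im z - Im z0 + Im h)%R by ring.
  eapply Rle_trans; [apply Rabs_triang|lra].
Qed.

(** * Powers of two and convergence of the lacunary series *)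

Lemma RtoC_neq_0 (x : R) : x <> 0%R -> RtoC x <> 0.
Proof. intros Hx H; apply Hx, RtoC_inj, H. Qed.

Lemma Cpow2_neq_0 (k : nat) : (2 : C) ^ k <> 0.
Proof. apply Cpow_nz, RtoC_neq_0; lra. Qed.

Lemma Rpow2_gt_0 (k : nat) : (0 < 2 ^ k)%R.
Proof. apply pow_lt; lra. Qed.

Lemma Cpow2_RtoC (k : nat) : (2 : C) ^ k = RtoC (2 ^ k)%R.
Proof. rewrite RtoC_pow; reflexivity. Qed.

Lemma Cdiv_pow2 (w : C) (k : nat) : w / 2 ^ k = (/ 2 ^ k)%R * w.
Proof.
rewrite RtoC_inv, <- Cpow2_RtoC by (apply Rgt_not_eq, Rpow2_gt_0).
unfold Cdiv; ring.
Qed.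

Lemma Cmod_div_pow2 (w : C) (k : nat) : (Cmod (w / 2 ^ k)%C = Cmod w / 2 ^ k)%R.
Proof.
pose proof (Rpow2_gt_0 k).
rewrite Cdiv_pow2, Cmod_mult, Cmod_R, Rabs_pos_eq.
- unfold Rdiv; ring.
- left; apply Rinv_0_lt_compat; assumption.
Qed.

Lemma Im_div_pow2 (w : C) (k : nat) : (Im (w / 2 ^ k)%C = Im w / 2 ^ k)%R.
Proof. rewrite Cdiv_pow2, im_scal_l; unfold Rdiv; ring. Qed.

Lemma exp_ge_monomial (x : R) (n : nat) :
  (0 <= x)%R -> (x ^ n / INR (fact n) <= exp x)%R.
Proof.
intros Hx; eapply Rle_trans; [|apply (exp_ge_taylor x n Hx)].
destruct n as [|n]; [apply Rle_refl|].
assert (0 <= sum_f_R0 (fun k => x ^ k / INR (fact k)) n)%R.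
{ apply cond_pos_sum; intro k; apply Rle_mult_inv_pos;
    [apply pow_le, Hx|apply INR_fact_lt_0]. }
change (x ^ S n / INR (fact (S n))
  <= sum_f_R0 (fun k => x ^ k / INR (fact k)) n + x ^ S n / INR (fact (S n)))%R.
lra.
Qed.

(** Comparing [exp (y * x)], where [x = 2^n], with its monomial of degree [S j] leaves a spare
    factor [1 / x], which is the geometric decay. *)
Lemma pow2_exp_decay (j : nat) (y : R) : (0 < y)%R -> exists K : R, forall n : nat,
  ((2 ^ n) ^ j * exp (- (y * 2 ^ n)) <= K * (1 / 2) ^ n)%R.
Proof.
intros Hy; exists (INR (fact (S j)) / y ^ S j)%R; intro n.
pose proof (Rpow2_gt_0 n) as Hx.
replace ((1 / 2) ^ n)%R with (/ 2 ^ n)%R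
  by (rewrite <- pow_inv; f_equal; lra).
set (x := (2 ^ n)%R) in *.
pose proof (exp_ge_monomial (y * x) (S j) ltac:(nra)) as He.
pose proof (INR_fact_lt_0 (S j)) as Hf; pose proof (pow_lt y (S j) Hy) as Hyp.
rewrite exp_Ropp.
apply Rmult_le_reg_r with (exp (y * x) * x * y ^ S j)%R.
{ apply Rmult_lt_0_compat; [apply Rmult_lt_0_compat|]; [apply exp_pos|exact Hx|exact Hyp]. }
replace (x ^ j * / exp (y * x) * (exp (y * x) * x * y ^ S j))%R
  with ((y * x) ^ S j)%R
  by (rewrite Rpow_mult_distr, <- (tech_pow_Rmult x); field; apply Rgt_not_eq, exp_pos).
replace (INR (fact (S j)) / y ^ S j * / x * (exp (y * x) * x * y ^ S j))%R
  with (INR (fact (S j)) * exp (y * x))%R by (field; lra).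
apply Rmult_le_compat_l with (r := INR (fact (S j))) in He; [|lra].
replace (INR (fact (S j)) * ((y * x) ^ S j / INR (fact (S j))))%R
  with ((y * x) ^ S j)%R in He by (field; lra).
exact He.
Qed.

Lemma is_series_half (K : R) : is_series (fun n => K * (1 / 2) ^ n)%R (K * 2)%R.
Proof.
assert (Hg : is_series (fun n => (1 / 2) ^ n)%R (/ (1 - 1 / 2))%R)
  by (apply is_series_geom; rewrite Rabs_pos_eq; lra).
replace (/ (1 - 1 / 2))%R with 2%R in Hg by field.
exact (is_series_scal K _ _ Hg).
Qed.

Lemma rapid_pow2 : rapid (fun n => 2 ^ n)%R.
Proof.
split; [intro n; left; apply Rpow2_gt_0|intros j y Hy].
destruct (pow2_exp_decay (S j) y Hy) as [K HK].
apply (@ex_series_le R_AbsRing R_CompleteNormedModule) with (fun n => K * (1 / 2) ^ n)%R.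
- intro n; change norm with Rabs; rewrite Rabs_pos_eq; [apply HK|].
  apply Rmult_le_pos; [apply pow_le; left; apply Rpow2_gt_0|left; apply exp_pos].
- eexists; apply is_series_half.
Qed.

Lemma rapid_inv_pow2 : rapid (fun n => / 2 ^ (n + 1))%R.
Proof.
assert (Hl : forall n, (0 < / 2 ^ (n + 1))%R)
  by (intro n; apply Rinv_0_lt_compat, Rpow2_gt_0).
split; [intro n; left; apply Hl|intros j y Hy].
apply (@ex_series_le R_AbsRing R_CompleteNormedModule) with (fun n => 1 * (1 / 2) ^ n)%R.
- intro n; change norm with Rabs; pose proof (Hl n) as H0.
  assert (Hle : (/ 2 ^ (n + 1) <= (1 / 2) ^ n)%R).
  { rewrite pow_add, Rinv_mult, <- pow_inv.
    replace (1 / 2)%R with (/ 2)%R by lra.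
    pose proof (pow_lt (/ 2) n ltac:(lra)); simpl; lra. }
  assert (Hle1 : (/ 2 ^ (n + 1) <= 1)%R).
  { eapply Rle_trans; [exact Hle|].
    pose proof (pow_incr (1 / 2) 1 n ltac:(lra)) as Hp; rewrite pow1 in Hp; exact Hp. }
  rewrite Rabs_pos_eq, <- tech_pow_Rmult.
  2:{ apply Rmult_le_pos; [apply pow_le; lra|left; apply exp_pos]. }
  set (x := (/ 2 ^ (n + 1))%R) in *.
  assert (x ^ j <= 1)%R by (rewrite <- (pow1 j); apply pow_incr; lra).
  assert (0 <= x ^ j)%R by (apply pow_le; lra).
  assert (exp (- (y * x)) <= 1)%R
    by (rewrite <- exp_0; left; apply exp_increasing; nra).
  pose proof (exp_pos (- (y * x))).
  apply Rle_trans with (x * 1)%R; [|lra].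
  rewrite Rmult_assoc; apply Rmult_le_compat_l; [lra|].
  rewrite <- (Rmult_1_l 1); apply Rmult_le_compat; lra.
- eexists; apply is_series_half.
Qed.

Lemma Cmod_e_minus_1 (u : C) :
  (Cmod (e u - 1)%C <= 2 * PI * Cmod u * exp (2 * PI * Cmod u))%R.
Proof.
pose proof (Cmod_Cexp_rem 1 (tau * u)) as H.
rewrite Cmod_mult, Cmod_tau, pow_1 in H.
replace (e u - 1) with (Cexp_rem 1 (tau * u)); [exact H|].
simpl; unfold e, tau; field.
Qed.

(* [G (w + 1)] up to a constant; [c m] is [G0 m]. *)
Definition G0 (w : C) : C := CSeries1 (fun l => e (w / 2 ^ l) - 1).

Lemma Cmod_G0_term (w : C) (n : nat) :
  (Cmod (e (w / 2 ^ (n + 1)) - 1)%C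
    <= PI * Cmod w * exp (2 * PI * Cmod w) * (1 / 2) ^ n)%R.
Proof.
pose proof PI_RGT_0; pose proof (Cmod_ge_0 w).
eapply Rle_trans; [apply Cmod_e_minus_1|].
rewrite Cmod_div_pow2, pow_add, pow_1.
pose proof (Rpow2_gt_0 n).
assert (Hp : (1 <= 2 ^ n)%R) by (rewrite <- (pow1 n); apply pow_incr; lra).
replace (2 * PI * (Cmod w / (2 ^ n * 2)))%R with (PI * Cmod w * (1 / 2) ^ n)%R.
2:{ replace ((1 / 2) ^ n)%R with (/ 2 ^ n)%R
      by (rewrite <- pow_inv; f_equal; lra).
    field; lra. }
assert (Hh : (0 < (1 / 2) ^ n <= 1)%R).
{ split; [apply pow_lt; lra|].
  pose proof (pow_incr (1 / 2) 1 n ltac:(lra)) as Hq; rewrite pow1 in Hq; exact Hq. }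
set (q := ((1 / 2) ^ n)%R) in *.
assert (He : (exp (PI * Cmod w * q) <= exp (2 * PI * Cmod w))%R).
{ assert (Hle : (PI * Cmod w * q <= 2 * PI * Cmod w)%R).
  { assert (0 <= PI * Cmod w)%R by (apply Rmult_le_pos; lra).
    assert (PI * Cmod w * q <= PI * Cmod w * 1)%R by (apply Rmult_le_compat_l; lra).
    lra. }
  destruct Hle as [Hlt| ->]; [left; apply exp_increasing, Hlt|apply Rle_refl]. }
apply Rle_trans with (PI * Cmod w * q * exp (2 * PI * Cmod w))%R; [|right; ring].
apply Rmult_le_compat_l; [|exact He].
apply Rmult_le_pos; [apply Rmult_le_pos|]; lra.
Qed.

Lemma G0_sums (w : C) : sums (fun n => e (w / 2 ^ (n + 1)) - 1) (G0 w).
Proof.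
destruct (sums_dominated _ _ _ (Cmod_G0_term w)
  (is_series_half (PI * Cmod w * exp (2 * PI * Cmod w)))) as [s [Hs _]].
unfold G0, CSeries1; rewrite (CSeries_unique _ _ Hs); exact Hs.
Qed.

Lemma F_sums (w : C) : (0 < Im w)%R -> sums (fun n => e (2 ^ n * w)) (F w).
Proof.
intros Hw; pose proof PI_RGT_0.
destruct (pow2_exp_decay 0 (2 * PI * Im w) ltac:(nra)) as [K HK].
destruct (sums_dominated (fun n => e (2 ^ n * w)) (fun n => K * (1 / 2) ^ n)%R (K * 2))
  as [s [Hs _]].
- intro n; eapply Rle_trans; [|apply HK].
  rewrite Cmod_e, Cpow2_RtoC, im_scal_l, pow_O, Rmult_1_l; right; f_equal; ring.
- apply is_series_half.
- unfold F; rewrite (CSeries_unique _ _ Hs); exact Hs.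
Qed.

(** * Functional equations of [S0] and the description of [V] *)

Definition S0 (w : C) : C := F w + G0 w.

Lemma Im_double (w : C) : Im (2 * w) = (2 * Im w)%R.
Proof. apply im_scal_l. Qed.

Lemma F_double (w : C) : (0 < Im w)%R -> F (2 * w) = F w - e w.
Proof.
intros Hw.
apply sums_unique with (fun n => e (2 ^ n * (2 * w))).
- apply F_sums; rewrite Im_double; lra.
- apply (sums_ext (fun n => e (2 ^ S n * w))).
  + intro n; f_equal; rewrite Cpow_S; ring.
  + replace (e w) with (e (2 ^ 0 * w)) by (f_equal; simpl; ring).
    apply (sums_tail (fun n => e (2 ^ n * w))), F_sums, Hw.
Qed.

Lemma G0_double (w : C) : G0 (2 * w) = e w - 1 + G0 w.
Proof.
apply sums_unique with (fun n => e (2 * w / 2 ^ (n + 1)) - 1); [apply G0_sums|].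
replace (e w - 1) with (e (2 * w / 2 ^ (0 + 1)) - 1)
  by (do 2 f_equal; simpl; field; apply RtoC_neq_0; lra).
apply (sums_cons (fun n => e (2 * w / 2 ^ (n + 1)) - 1)).
apply (sums_ext (fun n => e (w / 2 ^ (n + 1)) - 1)); [|apply G0_sums].
intro n; do 2 f_equal; change (S n + 1)%nat with (S (n + 1)).
rewrite Cpow_S; field; apply Cpow2_neq_0.
Qed.

(** Doubling shifts the index by one: the term [e w] leaves [F] and enters [G0] as [e w - 1]. *)
Lemma S0_double (w : C) : (0 < Im w)%R -> S0 (2 * w) = S0 w - 1.
Proof. intros Hw; unfold S0; rewrite F_double, G0_double by exact Hw; ring. Qed.

Lemma S0_pow2 (w : C) (k : nat) : (0 < Im w)%R -> S0 (2 ^ k * w) = S0 w - INR k.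
Proof.
intros Hw; induction k as [|k IH].
- simpl; rewrite Cmult_1_l; ring.
- rewrite Cpow_S, <- Cmult_assoc, S0_double, IH, S_INR, RtoC_plus; [ring|].
  rewrite Cpow2_RtoC, im_scal_l; pose proof (Rpow2_gt_0 k); nra.
Qed.

Lemma S0_div_pow2 (w : C) (k : nat) : (0 < Im w)%R -> S0 (w / 2 ^ k) = S0 w + INR k.
Proof.
intros Hw.
rewrite <- (Cmult_1_l w) at 2; rewrite <- (Cinv_r (2 ^ k) (Cpow2_neq_0 k)).
replace (2 ^ k * / 2 ^ k * w) with (2 ^ k * (w / 2 ^ k)) by (unfold Cdiv; ring).
rewrite S0_pow2; [ring|].
rewrite Im_div_pow2; apply Rdiv_lt_0_compat; [exact Hw|apply Rpow2_gt_0].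
Qed.

Lemma F_plus_IZR (w : C) (m : Z) : (0 < Im w)%R -> F (w + IZR m) = F w.
Proof.
intros Hw; apply sums_unique with (fun n => e (2 ^ n * (w + IZR m))).
- apply F_sums; rewrite im_plus, im_RtoC; lra.
- apply (sums_ext (fun n => e (2 ^ n * w))); [|apply F_sums, Hw].
  intro n; rewrite <- (e_plus_IZR (2 ^ n * w) (2 ^ Z.of_nat n * m)); f_equal.
  rewrite mult_IZR, <- pow_IZR, RtoC_mult, Cpow2_RtoC; ring.
Qed.

(** The twist [e (- (1 / 2^l))] cancels the shift: each term of [G (w + 1)] becomes
    [e (w / 2^l) - e (- (1 / 2^l))], a difference of two terms of [G0]. *)
Lemma Sfun_plus_1 (w : C) : (0 < Im w)%R -> Sfun (w + 1) = S0 w - G0 (- (1)).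
Proof.
intros Hw; unfold Sfun, S0; rewrite (F_plus_IZR w 1 Hw).
replace (G (w + 1)) with (G0 w - G0 (- (1))); [ring|].
symmetry; unfold G, CSeries1; apply CSeries_unique.
apply (sums_ext (fun n => (e (w / 2 ^ (n + 1)) - 1) - (e (- (1) / 2 ^ (n + 1)) - 1))).
- intro n; replace (w / 2 ^ (n + 1)) with
    (- (1 / 2 ^ (n + 1)) + (w + 1) / 2 ^ (n + 1)) by (field; apply Cpow2_neq_0).
  rewrite e_plus; replace (- (1) / 2 ^ (n + 1)) with (- (1 / 2 ^ (n + 1)))
    by (field; apply Cpow2_neq_0); ring.
- apply sums_minus; apply G0_sums.
Qed.

(** Translation by 1 preserves the half-plane, so [V] is a fixed translate of the image of [S0], and
    both claims reduce to that image. *)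
Lemma V_iff (z : C) : V z <-> exists w : C, (0 < Im w)%R /\ z = S0 w - G0 (- (1)).
Proof.
split.
- intros [w [Hw ->]]; exists (w - 1); unfold upper_half_plane in Hw.
  assert (Hw' : (0 < Im (w - 1))%R) by (destruct w; simpl in *; lra).
  split; [exact Hw'|].
  rewrite <- Sfun_plus_1 by exact Hw'; f_equal; ring.
- intros [w [Hw ->]]; exists (w + 1); split.
  + unfold upper_half_plane; destruct w; simpl in *; lra.
  + symmetry; apply Sfun_plus_1, Hw.
Qed.

Lemma S0_plus_IZR_image (w : C) (n : Z) : (0 < Im w)%R ->
  exists w' : C, (0 < Im w')%R /\ S0 w' = S0 w + IZR n.
Proof.
intros Hw; destruct (Z_le_gt_dec 0 n) as [Hn|Hn].
- exists (w / 2 ^ Z.to_nat n); split.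
  + rewrite Im_div_pow2; apply Rdiv_lt_0_compat; [exact Hw|apply Rpow2_gt_0].
  + rewrite S0_div_pow2, INR_IZR_INZ, Z2Nat.id by assumption; reflexivity.
- exists (2 ^ Z.to_nat (- n) * w); split.
  + rewrite Cpow2_RtoC, im_scal_l; pose proof (Rpow2_gt_0 (Z.to_nat (- n))); nra.
  + rewrite S0_pow2, INR_IZR_INZ, Z2Nat.id, opp_IZR, RtoC_opp by (assumption || lia); ring.
Qed.

(** * Local non-constancy of [S0] *)

Definition S0_deriv (j : nat) (z : C) : C :=
  CSeries (deriv_term (fun n => 2 ^ n)%R j z)
  + CSeries (deriv_term (fun n => / 2 ^ (n + 1))%R j z).

Lemma S0_taylor : has_taylor S0 S0_deriv.
Proof.
apply (has_taylor_plus F G0).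
- apply (series_taylor _ 0); [apply rapid_pow2|intros z Hz].
  apply (sums_ext (fun n => e (2 ^ n * z))); [|apply F_sums, Hz].
  intro n; rewrite Cpow2_RtoC; ring.
- apply (series_taylor _ 1); [apply rapid_inv_pow2|intros z Hz].
  apply (sums_ext (fun n => e (z / 2 ^ (n + 1)) - 1)); [|apply G0_sums].
  intro n; rewrite Cdiv_pow2; reflexivity.
Qed.

Lemma pow2_bracket (x : R) (n : nat) : (1 < x <= 2 ^ n)%R ->
  exists j : nat, (2 ^ j < x <= 2 ^ S j)%R.
Proof.
induction n as [|n IH]; intros [H1 H2]; [simpl in H2; lra|].
destruct (Rle_lt_dec x (2 ^ n)) as [Hle|Hlt]; [exact (IH (conj H1 Hle))|].
exists n; split; assumption.
Qed.

Lemma pow2_ge_succ (n : nat) : (INR n + 1 <= 2 ^ n)%R.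
Proof.
induction n as [|n IH]; [simpl; lra|].
rewrite S_INR, <- tech_pow_Rmult; pose proof (pos_INR n); lra.
Qed.

Lemma exp_mult_INR (x : R) (n : nat) : exp (INR n * x) = (exp x ^ n)%R.
Proof.
induction n as [|n IH].
- rewrite Rmult_0_l; apply exp_0.
- rewrite S_INR, Rmult_plus_distr_r, exp_plus, IH, Rmult_1_l, <- tech_pow_Rmult; ring.
Qed.

Lemma exp_le_compat (x y : R) : (x <= y)%R -> (exp x <= exp y)%R.
Proof. intros [Hlt| ->]; [left; apply exp_increasing, Hlt|apply Rle_refl]. Qed.

(* High up in the half-plane there is an order [J] of differentiation with
   [2^J] of size about [exp (x/2)], where [x = 2 pi Im z], for which the term
   [e z] of the two-sided series dominates all the others together. *)
Lemma S0_deriv_neq_0 (z : C) : (62 <= 2 * PI * Im z)%R ->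
  exists j : nat, S0_deriv (S j) z <> 0.
Proof.
intros Hx; pose proof PI_RGT_0 as Hpi.
assert (Hz : (0 < Im z)%R) by nra.
set (x := (2 * PI * Im z)%R) in *.
(* The bound 62 enters as [1 + 62 / 2 = 32]. Below, [J] satisfies
   [4 * exp (x / 2) <= 2^J < 8 * exp (x / 2)]: the left side gives [p <= 1/4], and the right side
   with 32 gives [q <= 1/4]. *)
assert (He : (32 <= exp (x / 2))%R) by (pose proof (exp_ineq1_le (x / 2)); lra).
destruct (Pow_x_infinity 2 ltac:(rewrite Rabs_pos_eq; lra) (4 * exp (x / 2))) as [n Hn].
specialize (Hn n (le_n n)); rewrite Rabs_pos_eq in Hn by (left; apply Rpow2_gt_0).
destruct (pow2_bracket (4 * exp (x / 2)) n ltac:(lra)) as [j [Hj1 Hj2]].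
exists j; set (J := S j) in *.
assert (HxE : exp x = (exp (x / 2) * exp (x / 2))%R)
  by (rewrite <- exp_plus; f_equal; field).
pose proof (exp_pos (x / 2)) as Hp; pose proof (Rpow2_gt_0 J) as HJ.
set (q := (2 ^ J * exp (- x))%R).
assert (Hq : (0 <= q <= 1 / 4)%R).
{ unfold q; rewrite exp_Ropp, HxE.
  split; [left; apply Rmult_lt_0_compat; [exact HJ|apply Rinv_0_lt_compat; nra]|].
  apply Rmult_le_reg_r with (exp (x / 2) * exp (x / 2))%R; [nra|].
  rewrite Rmult_assoc, Rinv_l by nra.
  unfold J; rewrite <- tech_pow_Rmult; nra. }
set (p := (/ 2 ^ J * exp (x / 2))%R).
assert (Hpq : (0 <= p <= 1 / 4)%R).
{ unfold p; split; [left; apply Rmult_lt_0_compat; [apply Rinv_0_lt_compat|]; assumption|].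
  apply Rmult_le_reg_l with (2 ^ J)%R; [exact HJ|].
  rewrite <- Rmult_assoc, Rinv_r by lra; lra. }
set (A := ((2 * PI) ^ J * exp (- x))%R).
assert (HA : (0 < A)%R) by (apply Rmult_lt_0_compat; [apply pow_lt; lra|apply exp_pos]).
assert (Hup : forall n,
  (Cmod (deriv_term (fun n => 2 ^ n)%R J z (S n)) <= A * (1 / 4) ^ S n)%R).
{ clear n Hn; intro n; rewrite Cmod_deriv_term by (left; apply Rpow2_gt_0); fold x.
  unfold A; rewrite Rmult_assoc; apply Rmult_le_compat_l; [apply pow_le; lra|].
  apply Rle_trans with (exp (- x) * q ^ S n)%R.
  - unfold q; rewrite Rpow_mult_distr, <- !pow_mult, (Nat.mul_comm J), <- exp_mult_INR.
    rewrite <- (Rmult_assoc (exp (- x))), (Rmult_comm (exp (- x))), Rmult_assoc, <- exp_plus.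
    apply Rmult_le_compat_l; [left; apply Rpow2_gt_0|apply exp_le_compat].
    pose proof (pow2_ge_succ (S n)); nra.
  - apply Rmult_le_compat_l; [left; apply exp_pos|apply pow_incr; exact Hq]. }
assert (Hdown : forall n,
  (Cmod (deriv_term (fun n => / 2 ^ (n + 1))%R J z n) <= A * (1 / 4) ^ S n)%R).
{ clear n Hn; intro n; rewrite Cmod_deriv_term
    by (left; apply Rinv_0_lt_compat, Rpow2_gt_0); fold x.
  unfold A; rewrite Rmult_assoc; apply Rmult_le_compat_l; [apply pow_le; lra|].
  replace (n + 1)%nat with (S n) by lia.
  apply Rle_trans with (exp (- x) * p ^ S n)%R.
  - unfold p; rewrite Rpow_mult_distr, !pow_inv, <- !pow_mult, (Nat.mul_comm J), <- exp_mult_INR.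
    rewrite <- (Rmult_assoc (exp (- x))), (Rmult_comm (exp (- x))), Rmult_assoc, <- exp_plus.
    apply Rmult_le_compat_l;
      [left; apply Rinv_0_lt_compat, Rpow2_gt_0|apply exp_le_compat].
    (* Equality holds at [n = 0]: the neighbour of frequency [1/2] is what forces [2^J] to exceed
       [exp (x / 2)]. *)
    assert (Hb : (1 - / 2 ^ S n <= INR (S n) / 2)%R).
    { clear; induction n as [|n IH]; [simpl; lra|].
      rewrite <- tech_pow_Rmult, Rinv_mult, S_INR.
      assert (Hle : (2 ^ 1 <= 2 ^ S n)%R) by (apply Rle_pow; [lra|lia]).
      apply Rinv_le_contravar in Hle; [|simpl; lra]; rewrite pow_1 in Hle.
      lra. }
    nra.
  - apply Rmult_le_compat_l; [left; apply exp_pos|apply pow_incr; exact Hpq]. }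
assert (H0 : Cmod (deriv_term (fun n => 2 ^ n)%R J z 0) = A).
{ rewrite Cmod_deriv_term by (simpl; lra); fold x; unfold A.
  simpl (2 ^ 0)%R; rewrite pow1, Rmult_1_l, Rmult_1_r; reflexivity. }
intro Hzero.
assert (Hsum := sums_plus _ _ _ _
  (sums_tail _ _ (deriv_sums _ j z rapid_pow2 Hz)) (deriv_sums _ j z rapid_inv_pow2 Hz)).
fold J in Hsum.
(* The two neighbours at distance [n + 1] contribute at most [2 * A * (1/4)^(n+1)]; the total
   [2 * A / 3] stays below the modulus [A] of the middle term. *)
assert (Hgeom : is_series (fun n => A / 2 * (1 / 4) ^ n)%R (A / 2 * (4 / 3))%R).
{ assert (Hg : is_series (fun n => (1 / 4) ^ n)%R (/ (1 - 1 / 4))%R)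
    by (apply is_series_geom; rewrite Rabs_pos_eq; lra).
  replace (/ (1 - 1 / 4))%R with (4 / 3)%R in Hg by field.
  exact (is_series_scal (A / 2)%R _ _ Hg). }
assert (Hle : (Cmod (CSeries (deriv_term (fun n => 2 ^ n)%R J z)
  - deriv_term (fun n => 2 ^ n)%R J z 0
  + CSeries (deriv_term (fun n => / 2 ^ (n + 1))%R J z))%C <= A / 2 * (4 / 3))%R).
{ apply (Cmod_sums_le _ _ _ _ Hsum) with (2 := Hgeom).
  clear n Hn; intro n; eapply Rle_trans; [apply Cmod_triangle|].
  specialize (Hup n); specialize (Hdown n); rewrite <- tech_pow_Rmult in Hup, Hdown.
  lra. }
unfold S0_deriv in Hzero.
replace (_ + _) with (- deriv_term (fun n => 2 ^ n)%R J z 0) in Hle.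
2:{ transitivity (0 - deriv_term (fun n => 2 ^ n)%R J z 0); [ring|].
    rewrite <- Hzero; ring. }
rewrite Cmod_opp, H0 in Hle; lra.
Qed.

(** Substituting [s * h] multiplies the leading coefficient by a power of [s]. Only increments are
    compared, so [f] may differ by a constant at the two points, as [S0] does under doubling. *)
Lemma leading_term_rescale (f : C -> C) (z z' s : C) (eta : R) :
  s <> 0 -> (0 < eta)%R ->
  (forall h, (Cmod h <= eta)%R -> f (z + h) - f z = f (z' + s * h) - f z') ->
  leading_term f z' -> leading_term f z.
Proof.
intros Hs Heta Hf (N & a & K & eta' & Ha & HK & Heta' & HN).
pose proof Hs as Hs'; apply Cmod_gt_0 in Hs'.
exists N, (a * s ^ S N), (K * Cmod s ^ S (S N))%R, (Rmin eta (eta' / Cmod s)).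
split; [|split; [|split]].
- apply Cmult_neq_0; [exact Ha|apply Cpow_nz, Hs].
- apply Rmult_le_pos; [exact HK|apply pow_le; lra].
- apply Rmin_pos; [exact Heta|apply Rdiv_lt_0_compat; assumption].
- intros h Hh.
  pose proof (Rmin_l eta (eta' / Cmod s)); pose proof (Rmin_r eta (eta' / Cmod s)).
  rewrite Hf by lra.
  rewrite <- Cmult_assoc, <- Cpow_mult_l, Rmult_assoc, <- Rpow_mult_distr, <- Cmod_mult.
  apply HN; rewrite Cmod_mult.
  replace eta' with (Cmod s * (eta' / Cmod s))%R by (field; lra).
  apply Rmult_le_compat_l; lra.
Qed.

Lemma Rabs_Im_le_Cmod (z : C) : (Rabs (Im z) <= Cmod z)%R.
Proof. exact (Rle_trans _ _ _ (Rmax_r _ _) (Rmax_Cmod z)). Qed.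

(** A power of two lifts [z] to the height where some derivative is nonzero, and the expansion found
    there is scaled back. *)
Lemma S0_leading_term (z : C) : (0 < Im z)%R -> leading_term S0 z.
Proof.
intros Hz; pose proof PI_RGT_0 as Hpi.
destruct (Pow_x_infinity 2 ltac:(rewrite Rabs_pos_eq; lra) (62 / (2 * PI * Im z)))
  as [k Hk].
specialize (Hk k (le_n k)); rewrite Rabs_pos_eq in Hk by (left; apply Rpow2_gt_0).
assert (Hk' : (62 <= 2 * PI * Im (2 ^ k * z))%R).
{ rewrite Cpow2_RtoC, im_scal_l.
  apply Rge_le, Rmult_le_compat_r with (r := (2 * PI * Im z)%R) in Hk; [|nra].
  replace (62 / (2 * PI * Im z) * (2 * PI * Im z))%R with 62%R in Hk by (field; lra).
  lra. }
destruct (S0_deriv_neq_0 _ Hk') as [j Hj].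
apply leading_term_rescale with (z' := 2 ^ k * z) (s := 2 ^ k) (eta := (Im z / 2)%R).
- apply Cpow2_neq_0.
- lra.
- intros h Hh; rewrite <- Cmult_plus_distr_l, !S0_pow2; [ring|exact Hz|].
  rewrite im_plus; pose proof (Rabs_Im_le_Cmod h) as Hi.
  apply Rabs_le_between in Hi; lra.
- apply (taylor_leading_term _ _ _ j S0_taylor); [nra|exact Hj].
Qed.

(** * Approximation of [S0 + c m] and proof of the theorem *)

(** The parts from [F] cancel by periodicity. In [G0] the defect of additivity of [e - 1] is the
    product [(e a - 1) * (e b - 1)]; the factor with [b = m / 2^l] real has modulus at most 2, the
    other one is summable with sum [O(|u|)]. *)
Lemma S0_shift_close (u : C) (m : Z) : (0 < Im u)%R ->
  (Cmod (S0 (u + IZR m) - (S0 u + c m))%C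
    <= 4 * PI * Cmod u * exp (2 * PI * Cmod u))%R.
Proof.
intros Hu; unfold S0; rewrite F_plus_IZR by exact Hu.
change (c m) with (G0 (IZR m)).
assert (Hs := sums_minus _ _ _ _ (sums_minus _ _ _ _ (G0_sums (u + IZR m)) (G0_sums u))
   (G0_sums (IZR m))).
replace (_ - _) with (G0 (u + IZR m) - G0 u - G0 (IZR m)) by ring.
set (K := (PI * Cmod u * exp (2 * PI * Cmod u))%R).
replace (4 * PI * Cmod u * exp (2 * PI * Cmod u))%R with (2 * K * 2)%R
  by (unfold K; ring).
apply (Cmod_sums_le _ (fun n => 2 * K * (1 / 2) ^ n)%R _ _ Hs); [|apply is_series_half].
intro n.
replace (_ - _) with ((e (IZR m / 2 ^ (n + 1)) - 1) * (e (u / 2 ^ (n + 1)) - 1)).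
2:{ replace ((u + IZR m) / 2 ^ (n + 1)) with (u / 2 ^ (n + 1) + IZR m / 2 ^ (n + 1))
      by (field; apply Cpow2_neq_0).
    rewrite e_plus; ring. }
rewrite Cmod_mult, Rmult_assoc.
apply Rmult_le_compat; [apply Cmod_ge_0|apply Cmod_ge_0| |apply Cmod_G0_term].
eapply Rle_trans; [apply Cmod_triangle|].
rewrite Cmod_opp, Cmod_1, Cmod_e, Im_div_pow2, im_RtoC.
unfold Rdiv; rewrite Rmult_0_l, Rmult_0_r, Ropp_0, exp_0; lra.
Qed.

Lemma S0_plus_c_image (w0 : C) (m : Z) : (0 < Im w0)%R ->
  exists w : C, (0 < Im w)%R /\ S0 w = S0 w0 + c m.
Proof.
intros Hw0; pose proof PI_RGT_0 as Hpi.
(* From [2 * r <= Im w0 / 8], the square stays above height [Im w0 / 2] and two of its points differ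
   by at most [4 * r <= Im w0 / 4], exactly the range allowed by the Lipschitz estimate at that
   height. *)
destruct (leading_term_lower_bound S0 w0 (Im w0 / 8) (S0_leading_term w0 Hw0) ltac:(lra))
  as (r & delta & Hr & Hr2 & Hdelta & Hlow).
assert (Hsq : forall z, in_square w0 r z ->
  (Cmod (z - w0)%C <= 2 * r)%R /\ (Im w0 / 2 <= Im z)%R).
{ intros z [H1 H2]; split.
  - eapply Rle_trans; [apply Cmod_le_Re_Im|].
    destruct z, w0; simpl in *; unfold Rminus in *; lra.
  - apply Rabs_le_between in H2; lra. }
set (W := (Cmod w0 + 2 * r)%R).
assert (HW : forall z, in_square w0 r z -> (Cmod z <= W)%R).
{ intros z Hz; replace z with (w0 + (z - w0)) by ring.
  eapply Rle_trans; [apply Cmod_triangle|]; pose proof (proj1 (Hsq z Hz)).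
  unfold W; lra. }
set (B := (4 * PI * W * exp (2 * PI * W))%R).
(* [B / 2^k] bounds the approximation error on the square; the factor 4 makes it at most
   [delta / 4]. *)
destruct (Pow_x_infinity 2 ltac:(rewrite Rabs_pos_eq; lra) (4 * B / delta)) as [k Hk].
specialize (Hk k (le_n k)); rewrite Rabs_pos_eq in Hk by (left; apply Rpow2_gt_0).
pose proof (Rpow2_gt_0 k) as Hk0.
assert (Hk1 : (1 <= 2 ^ k)%R) by (rewrite <- (pow1 k); apply pow_incr; lra).
pose proof (Cmod_ge_0 w0) as Hcw0.
assert (HB0 : (0 < B)%R).
{ unfold B; apply Rmult_lt_0_compat; [|apply exp_pos].
  apply Rmult_lt_0_compat; unfold W; lra. }
assert (HBk : (B / 2 ^ k < delta / 2)%R).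
{ apply Rmult_lt_reg_r with (2 ^ k)%R; [exact Hk0|].
  replace (B / 2 ^ k * 2 ^ k)%R with B by (field; lra).
  apply Rge_le, Rmult_le_compat_r with (r := delta) in Hk; [|lra].
  replace (4 * B / delta * delta)%R with (4 * B)%R in Hk by (field; lra).
  lra. }
assert (Him : forall z, Im (z / 2 ^ k + IZR m) = (Im z / 2 ^ k)%R)
  by (intro z; rewrite im_plus, Im_div_pow2, im_RtoC; ring).
(* [L] depends on [k] and may be huge near the real axis; this is harmless, as it only serves to
   attain a minimum with [k] fixed. *)
destruct (taylor_lipschitz S0 S0_deriv (Im w0 / 2 / 2 ^ k) S0_taylor) as (L & HL & Hlip).
{ apply Rdiv_lt_0_compat; lra. }
assert (Hdiv : forall x y, (x <= y)%R -> (x / 2 ^ k <= y / 2 ^ k)%R).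
{ intros x y Hxy; apply Rmult_le_compat_r;
    [left; apply Rinv_0_lt_compat, Hk0|exact Hxy]. }
destruct (hurwitz_square (fun z => S0 z + c m)
  (fun z => S0 (z / 2 ^ k + IZR m) - INR k) w0 r delta L) as (z & Hz & Heq).
- lra.
- exact HL.
- intros z Hz Hb.
  replace (S0 z + c m - (S0 w0 + c m)) with (S0 (w0 + (z - w0)) - S0 w0)
    by (replace (w0 + (z - w0)) with z by ring; ring).
  apply Hlow; split; [|apply Hsq, Hz].
  pose proof (re_le_Cmod (z - w0)) as H1; pose proof (Rabs_Im_le_Cmod (z - w0)) as H2.
  destruct z, w0; simpl in *; unfold Rminus in *; destruct Hb; lra.
- intros z Hz; pose proof (proj2 (Hsq z Hz)) as Hi; specialize (HW z Hz).
  assert (Hu : (0 < Im (z / 2 ^ k))%R)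
    by (rewrite Im_div_pow2; apply Rdiv_lt_0_compat; lra).
  pose proof (S0_shift_close (z / 2 ^ k) m Hu) as Hc.
  rewrite S0_div_pow2 in Hc by lra.
  replace (_ - _) with (S0 (z / 2 ^ k + IZR m) - (S0 z + INR k + c m)) by ring.
  eapply Rle_lt_trans; [exact Hc|].
  eapply Rle_lt_trans; [|exact HBk].
  rewrite Cmod_div_pow2.
  pose proof (Cmod_ge_0 z) as Hcz.
  assert (Hzk : (0 <= Cmod z / 2 ^ k <= Cmod z)%R).
  { split; [apply Rle_mult_inv_pos; lra|].
    apply Rmult_le_reg_r with (2 ^ k)%R; [exact Hk0|].
    replace (Cmod z / 2 ^ k * 2 ^ k)%R with (Cmod z) by (field; lra); nra. }
  unfold B; replace (4 * PI * W * exp (2 * PI * W) / 2 ^ k)%R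
    with (4 * PI * (W / 2 ^ k) * exp (2 * PI * W))%R by (field; lra).
  apply Rmult_le_compat; [apply Rmult_le_pos; lra|left; apply exp_pos| |].
  + apply Rmult_le_compat_l; [lra|apply Hdiv, HW].
  + apply exp_le_compat, Rmult_le_compat_l; lra.
- intros z w Hz Hw.
  destruct (Hsq z Hz) as [Hz1 Hz2], (Hsq w Hw) as [Hw1 Hw2].
  replace (S0 (z / 2 ^ k + IZR m) - INR k - (S0 (w / 2 ^ k + IZR m) - INR k))
    with (S0 (w / 2 ^ k + IZR m + (z - w) / 2 ^ k) - S0 (w / 2 ^ k + IZR m)).
  2:{ replace (w / 2 ^ k + IZR m + (z - w) / 2 ^ k) with (z / 2 ^ k + IZR m)
        by (field; apply Cpow2_neq_0); ring. }
  assert (Hd : (Cmod (z - w) <= 4 * r)%R).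
  { replace (z - w) with ((z - w0) + - (w - w0)) by ring.
    eapply Rle_trans; [apply Cmod_triangle|]; rewrite Cmod_opp; lra. }
  eapply Rle_trans; [apply Hlip|].
  + rewrite Him; apply Hdiv, Hw2.
  + rewrite Cmod_div_pow2.
    replace (Im w0 / 2 / 2 ^ k / 2)%R with (Im w0 / 4 / 2 ^ k)%R by (field; lra).
    apply Hdiv; lra.
  + rewrite Cmod_div_pow2; apply Rmult_le_compat_l; [exact HL|].
    apply Rmult_le_reg_r with (2 ^ k)%R; [exact Hk0|].
    replace (Cmod (z - w)%C / 2 ^ k * 2 ^ k)%R with (Cmod (z - w)) by (field; lra).
    pose proof (Cmod_ge_0 (z - w)); nra.
- intros z rho Hz Hne Hrho; pose proof (proj2 (Hsq z Hz)) as Hi.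
  destruct (leading_term_descent S0 (z / 2 ^ k + IZR m) (S0 w0 + c m + INR k) (rho / 2 ^ k))
    as (h & Hh & Hlt).
  + apply S0_leading_term; rewrite Him; apply Rdiv_lt_0_compat; lra.
  + intro Heq; apply Hne; rewrite Heq; ring.
  + apply Rdiv_lt_0_compat; lra.
  + exists (2 ^ k * h); split.
    * rewrite Cpow2_RtoC, Cmod_mult, Cmod_R, Rabs_pos_eq by lra.
      replace rho with (2 ^ k * (rho / 2 ^ k))%R by (field; lra).
      apply Rmult_lt_compat_l; assumption.
    * replace ((z + 2 ^ k * h) / 2 ^ k + IZR m) with (z / 2 ^ k + IZR m + h)
        by (field; apply Cpow2_neq_0).
      replace (S0 (z / 2 ^ k + IZR m + h) - INR k - (S0 w0 + c m)) with
        (S0 (z / 2 ^ k + IZR m + h) - (S0 w0 + c m + INR k)) by ring.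
      replace (S0 (z / 2 ^ k + IZR m) - INR k - (S0 w0 + c m)) with
        (S0 (z / 2 ^ k + IZR m) - (S0 w0 + c m + INR k)) by ring.
      exact Hlt.
- assert (Hi : (0 < Im (z / 2 ^ k + IZR m))%R).
  { rewrite Him; apply Rdiv_lt_0_compat; [|exact Hk0].
    pose proof (proj2 (Hsq z Hz)); lra. }
  (* Doubling [u] another [k] times absorbs the remaining integer [- k], so the value is attained
     exactly. *)
  set (u := z / 2 ^ k + IZR m) in *; exists (2 ^ k * u); split.
  + rewrite Cpow2_RtoC, im_scal_l; apply Rmult_lt_0_compat; assumption.
  + rewrite S0_pow2 by exact Hi; exact Heq.
Qed.

Theorem proposition1p2 :
  (forall z : C, plus_Z V z <-> V z) /\
  (forall (m : Z) (z : C), translate V (c m) z -> V z).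
Proof.
split.
- intro z; split.
  + intros (v & n & Hv & ->); apply V_iff in Hv as (w & Hw & ->).
    destruct (S0_plus_IZR_image w n Hw) as (w' & Hw' & Heq).
    apply V_iff; exists w'; split; [exact Hw'|rewrite Heq; ring].
  + intro Hz; exists z, 0%Z; split; [exact Hz|ring].
- intros m z (v & Hv & ->); apply V_iff in Hv as (w & Hw & ->).
  destruct (S0_plus_c_image w m Hw) as (w' & Hw' & Heq).
  apply V_iff; exists w'; split; [exact Hw'|rewrite Heq; ring].
Qed.
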